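(* Let $d\ge2$, let $T\in\mathbb{R}^{n_1\times\cdots\times n_d}$ be a tensor given by a TR-representation with cores $G_k\in\mathbb{R}^{r_{k-1}\times n_k\times r_k}$, $k=1,\ldots,d$, $r_d=r_0$, and let $\varepsilon\ge 0$. The TR-rounding algorithm applied to these cores with accuracy $\varepsilon$ returns cores $\widetilde G_1,\ldots,\widetilde G_d$ whose corresponding tensor $\widetilde T(i_1,\ldots,i_d)=\operatorname{Trace}(\widetilde G_1(i_1)\cdots\widetilde G_d(i_d))$ satisfies $\|T-\widetilde T\|_F\le\varepsilon\|T\|_F$.
   Context: TR-format: cores $G_k\in\mathbb{R}^{r_{k-1}\times n_k\times r_k}$ ($k=1,\ldots,d$, $r_d=r_0$), with matrix slices $G_k(i_k)\in\mathbb{R}^{r_{k-1}\times r_k}$, represent $T(i_1,\ldots,i_d)=\operatorname{Trace}(G_1(i_1)\cdots G_d(i_d))$. The Frobenius norm is $\|T\|_F^2=\sum_{i_1,\ldots,i_d}|T(i_1,\ldots,i_d)|^2$. Conventions: the $k$-mode product of a tensor $X$ with a matrix $A$ is $(X\times_kA)(i_1,\ldots,i_{k-1},j,i_{k+1},\ldots)=\sum_{i_k}X(i_1,i_2,\ldots)A(j,i_k)$. For a matrix $A$, $\mathrm{SVD}_\delta(A)$ denotes a $\delta$-truncated SVD: matrices $U,\Sigma,V$, with $U,V$ having orthonormal columns and $\Sigma$ square diagonal with positive diagonal entries, obtained by truncating an SVD of $A$ to the smallest rank for which $\|A-U\Sigma V^T\|_F\le\delta$. QR denotes a reduced QR-decomposition: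 for a $p\times q$ matrix, the factor $Q$ has $\min(p,q)$ orthonormal columns. Reshapes use MATLAB (column-major) ordering. If some rank becomes $0$, the represented tensor is $0$. TR-rounding algorithm (input: cores $G_1,\ldots,G_d$ of $T$, accuracy $\varepsilon$). Put $\delta=\varepsilon\|T\|_F/\sqrt{d\,r_0}$ (with the input value of $r_0$). (1) QR-sweep: for $k=1,\ldots,d-1$, compute the QR-decomposition $Q_kR_k$ of $G_k$ reshaped to size $r_{k-1}n_k\times r_k$; replace $r_k$ by the number of columns of $Q_k$, $G_k$ by $Q_k$ reshaped to size $r_{k-1}\times n_k\times r_k$, and $G_{k+1}$ by $G_{k+1}\times_1R_k$. (2) Cyclic step: compute the QR-decomposition $Q_dR_d$ of $G_d$ reshaped to size $r_{d-1}n_d\times r_d$, and $[U_d,\Sigma_d,V_d]=\mathrm{SVD}_\delta(R_d)$; let $\widetilde r_d=\operatorname{rank}(\Sigma_d)$. If $\widetilde r_d<r_d$, replace $G_d$ by $Q_dU_d\Sigma_d$ reshaped to size $r_{d-1}\times n_d\times\widetilde r_d$ and $G_1$ by $G_1\times_1V_d^T$; otherwise leave $G_d$ and $G_1$ unchanged. (3) SVD-sweep: for $k=d,d-1,\ldots,2$, compute $[U_k,\Sigma_k,V_k]=\mathrm{SVD}_\delta$ of $G_k$ reshaped to size $r_{k-1}\times n_k\widetilde r_k$; let $\widetilde r_{k-1}=\operatorname{rank}(\Sigma_k)$, let $\widetilde G_k$ be $V_k^T$ reshaped to size $\widetilde r_{k-1}\times n_k\times\widetilde r_k$, and replace $G_{k-1}$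 by $G_{k-1}\times_3(U_k\Sigma_k)^T$. (4) Set $\widetilde G_1=G_1$ and return $\widetilde G_1,\ldots,\widetilde G_d$. *)

(* Defs.v *)
From mathcomp Require Import all_boot all_order all_algebra.
From mathcomp Require Import mxtens.

Set Implicit Arguments.
Unset Strict Implicit.
Unset Printing Implicit Defensive.

Import Order.TTheory GRing.Theory Num.Theory.
Local Open Scope ring_scope.

(* Everything is 0-based: core number [k] (k = 0, .., d - 1) is the G_{k+1} of
   the usual 1-based notation and has mode size [n k]; only the values
   [n 0, .., n d.-1] are ever used. *)

(** * Tensors and TR-format *)

Definition mindex (n : nat -> nat) (d : nat) := {dffun forall k : 'I_d, 'I_(n k)}.

Definition tensor (R : Type) (n : nat -> nat) (d : nat) := mindex n d -> R.

Definition frob (R : rcfType) (I : finType) (f : I -> R) : R :=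
  Num.sqrt (\sum_i `|f i| ^+ 2).

Definition mxfrob (R : rcfType) (p q : nat) (A : 'M[R]_(p, q)) : R :=
  frob (fun ij : 'I_p * 'I_q => A ij.1 ij.2).

(* A core of size a x n x b, given by its matrix slices. *)
Definition core (R : Type) (a n b : nat) := 'I_n -> 'M[R]_(a, b).

(* [train R n a k b]: cores number 0, .., k - 1 (with k > 0) of matching ranks,
   of which the first has left rank [a] and the last has right rank [b].  The
   intermediate ranks are arbitrary. *)
Inductive train (R : Type) (n : nat -> nat) (a : nat) : nat -> nat -> Type :=
| One b : core R a (n 0%N) b -> train R n a 1 b
| Snoc k b c : train R n a k b -> core R b (n k) c -> train R n a k.+1 c.

Record tr_format (R : Type) (n : nat -> nat) (d : nat) := TR {
  tr_rank : nat;                            (* r_0 = r_d *)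
  tr_cores : train R n tr_rank d tr_rank }.

(* The product G_1(i_1) ... G_k(i_k). *)
Fixpoint slice_prod (R : rcfType) n a k b (G : train R n a k b) :
    (forall j : 'I_k, 'I_(n j)) -> 'M[R]_(a, b) :=
  match G with
  | One _ C => fun i => C (i ord0)
  | Snoc k' _ _ G' C => fun i =>
      slice_prod G' (fun j => i (widen_ord (leqnSn k') j)) *m C (i ord_max)
  end.

(* If some rank is 0 this is identically 0. *)
Definition tr_tensor (R : rcfType) n d (G : tr_format R n d) : tensor R n d :=
  fun i => \tr (slice_prod (tr_cores G) i).

(** * Reshapes, in column-major order *)

(* [mxtens_index (x, y)] is x * (range of y) + y, so that the second
   component varies fastest. *)

Definition unfoldL (R : Type) a n b (C : core R a n b) : 'M[R]_(n * a, b) :=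
  \matrix_(p, j) C (mxtens_unindex p).1 (mxtens_unindex p).2 j.

Definition foldL (R : Type) a n b (A : 'M[R]_(n * a, b)) : core R a n b :=
  fun x => \matrix_(i, j) A (mxtens_index (x, i)) j.

Definition unfoldR (R : Type) a n b (C : core R a n b) : 'M[R]_(a, b * n) :=
  \matrix_(i, p) C (mxtens_unindex p).2 i (mxtens_unindex p).1.

Definition foldR (R : Type) a n b (A : 'M[R]_(a, b * n)) : core R a n b :=
  fun x => \matrix_(i, j) A i (mxtens_index (j, x)).

(* C x_1 A *)
Definition mode1 (R : rcfType) a a' n b (C : core R a n b) (A : 'M[R]_(a', a)) :
  core R a' n b := fun x => A *m C x.

(* C x_3 A *)
Definition mode3 (R : rcfType) a n b b' (C : core R a n b) (A : 'M[R]_(b', b)) :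
  core R a n b' := fun x => C x *m A^T.

(** * Matrix factorizations *)

Definition orthocols (R : rcfType) p q (Q : 'M[R]_(p, q)) := Q^T *m Q = 1%:M.

Definition is_qr (R : rcfType) p q (A : 'M[R]_(p, q))
    (Q : 'M[R]_(p, minn p q)) (T : 'M[R]_(minn p q, q)) : Prop :=
  [/\ A = Q *m T, orthocols Q & forall (i : 'I_(minn p q)) (j : 'I_q), (j < i)%N -> T i j = 0].

(* Reduced SVD A = U diag(s) V^T with nonincreasing singular values. *)
Definition is_svd (R : rcfType) p q (A : 'M[R]_(p, q)) (U : 'M[R]_(p, minn p q))
    (s : 'rV[R]_(minn p q)) (V : 'M[R]_(q, minn p q)) : Prop :=
  [/\ A = U *m diag_mx s *m V^T, orthocols U, orthocols V,
      forall i, 0 <= s 0 i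
    & forall i j : 'I_(minn p q), (i <= j)%N -> s 0 j <= s 0 i].

(* Since [tsvdS] is only used with positive diagonal entries, its rank is its
   size [tsvd_rank]. *)
Record tsvd (R : Type) (p q : nat) := TSVD {
  tsvd_rank : nat;
  tsvdU : 'M[R]_(p, tsvd_rank);
  tsvdS : 'M[R]_tsvd_rank;
  tsvdV : 'M[R]_(q, tsvd_rank) }.

Definition tsvd_mx (R : rcfType) p q (F : tsvd R p q) : 'M[R]_(p, q) :=
  tsvdU F *m tsvdS F *m (tsvdV F)^T.

Definition truncate (R : rcfType) p q m (U : 'M[R]_(p, m)) (s : 'rV[R]_m)
    (V : 'M[R]_(q, m)) (r : nat) (le_rm : (r <= m)%N) : tsvd R p q :=
  TSVD (colsub (widen_ord le_rm) U) (diag_mx (colsub (widen_ord le_rm) s))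
       (colsub (widen_ord le_rm) V).

Definition is_tsvd (R : rcfType) p q (delta : R) (A : 'M[R]_(p, q))
    (F : tsvd R p q) : Prop :=
  exists U s V, is_svd A U s V /\
  exists (r : nat) (le_r : (r <= minn p q)%N),
  [/\ F = truncate U s V le_r,
      mxfrob (A - tsvd_mx F) <= delta,
      forall i, 0 < tsvdS F i i
    & forall (r' : nat) (le_r' : (r' <= minn p q)%N),
        mxfrob (A - tsvd_mx (truncate U s V le_r')) <= delta -> (r <= r')%N].

(* QR and SVD are not unique; the rounding algorithm is a function of the
   routines that compute them. *)
Definition qr_routine (R : rcfType) :=
  forall p q, 'M[R]_(p, q) -> 'M[R]_(p, minn p q) * 'M[R]_(minn p q, q).

Definition qr_correct (R : rcfType) (qr : qr_routine R) : Prop :=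
  forall p q (A : 'M[R]_(p, q)), is_qr A (qr p q A).1 (qr p q A).2.

Definition svd_routine (R : rcfType) :=
  forall p q, R -> 'M[R]_(p, q) -> tsvd R p q.

Definition svd_correct (R : rcfType) (svd : svd_routine R) : Prop :=
  forall p q (delta : R) (A : 'M[R]_(p, q)),
    0 <= delta -> is_tsvd delta A (svd p q delta A).

(** * TR-rounding *)

(* The QR-sweep over a train: the new train, of right rank [b'], and the last
   R-factor, which is still to be multiplied into the next core. *)
Fixpoint qr_sweep (R : rcfType) (qr : qr_routine R) n a k b
    (G : train R n a k b) : {b' : nat & (train R n a k b' * 'M[R]_(b', b))%type} :=
  match G with
  | One _ C => let QT := qr _ _ (unfoldL C) in existT _ _ (One (foldL QT.1), QT.2)
  | Snoc _ _ _ G' C =>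
      let: existT _ (G'', T) := qr_sweep qr G' in
      let QT := qr _ _ (unfoldL (mode1 C T)) in
      existT _ _ (Snoc G'' (foldL QT.1), QT.2)
  end.

Fixpoint mode1_first (R : rcfType) n a a' k b (A : 'M[R]_(a', a))
    (G : train R n a k b) : train R n a' k b :=
  match G with
  | One _ C => One (mode1 C A)
  | Snoc _ _ _ G' C => Snoc (mode1_first A G') C
  end.

(* The cyclic step for the cores [Snoc G C]; the resulting common value of r_0
   and r_d comes first. *)
Definition cyclic_step (R : rcfType) (qr : qr_routine R) (svd : svd_routine R)
    (delta : R) n a k b (G : train R n a k b) (C : core R b (n k) a) :
    {r : nat & (train R n r k b * core R b (n k) r)%type} :=
  let QT := qr _ _ (unfoldL C) in
  let F := svd _ _ delta QT.2 in
  if (tsvd_rank F < a)%N then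
    existT _ (tsvd_rank F)
      (mode1_first (tsvdV F)^T G, foldL (QT.1 *m tsvdU F *m tsvdS F))
  else existT _ a (G, C).

(* The SVD-sweep for the cores [Snoc G C]. *)
Fixpoint svd_sweep (R : rcfType) (svd : svd_routine R) (delta : R) n a k b
    (G : train R n a k b) :
    forall c, core R b (n k) c -> train R n a k.+1 c :=
  match G with
  | One _ C' => fun _ C =>
      let F := svd _ _ delta (unfoldR C) in
      Snoc (One (mode3 C' (tsvdU F *m tsvdS F)^T)) (foldR (tsvdV F)^T)
  | Snoc _ _ _ G' C' => fun _ C =>
      let F := svd _ _ delta (unfoldR C) in
      Snoc (svd_sweep svd delta G' (mode3 C' (tsvdU F *m tsvdS F)^T))
           (foldR (tsvdV F)^T)
  end.

Definition unsnoc (R : Type) n a k c (G : train R n a k.+2 c) :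
    {b : nat & (train R n a k.+1 b * core R b (n k.+1) c)%type} :=
  match G in train _ _ _ k' c' return
    match k' return Type with
    | k0.+2 => {b : nat & (train R n a k0.+1 b * core R b (n k0.+1) c')%type}
    | _ => unit
    end
  with
  | One _ _ => tt
  | Snoc k' b c' G' C =>
      match k' return
        train R n a k' b -> core R b (n k') c' ->
        match k'.+1 return Type with
        | k0.+2 => {b : nat & (train R n a k0.+1 b * core R b (n k0.+1) c')%type}
        | _ => unit
        end
      with
      | 0 => fun _ _ => tt
      | k0.+1 => fun G'' C' => existT _ b (G'', C')
      end G' C
  end.

(* If r_0 = 0 the tensor is 0, and delta = 0 by the convention x / 0 = 0. *)
Definition tr_rounding2 (R : rcfType) (qr : qr_routine R) (svd : svd_routine R)
    (eps : R) n d (G : tr_format R n d.+2) : tr_format R n d.+2 :=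
  let delta :=
    eps * frob (tr_tensor G) / Num.sqrt (d.+2 * tr_rank G)%:R in
  let: existT _ (G1, C1) := unsnoc (tr_cores G) in
  let: existT _ (G2, T) := qr_sweep qr G1 in
  let: existT _ (G3, C3) := cyclic_step qr svd delta G2 (mode1 C1 T) in
  TR (svd_sweep svd delta G3 C3).

(* The algorithm is only meant for d >= 2; otherwise the input is returned. *)
Definition tr_rounding (R : rcfType) (qr : qr_routine R) (svd : svd_routine R)
    (eps : R) n d : tr_format R n d -> tr_format R n d :=
  match d with
  | d'.+2 => @tr_rounding2 R qr svd eps n d'
  | _ => id
  end.

(* Main.v *)
Require Import Defs.
From mathcomp Require Import all_boot all_order all_algebra.
From mathcomp Require Import mxtens.
From mathcomp Require Import ring.

Set Implicit Arguments.
Unset Strict Implicit.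
Unset Printing Implicit Defensive.

Import Order.TTheory GRing.Theory Num.Theory.
Local Open Scope ring_scope.

(** Why the error bound holds.

Before the trace is taken, the slice products of a train with left rank a and
right rank b form a family of a x b matrices indexed by the multi-index, and
the squared Frobenius norms of the members add up.  For this open train the
claim is that the cyclic step and the d - 1 truncations of the SVD-sweep each
contribute at most delta^2, and that their contributions add up in squares, so
that the open error is at most d delta^2.  The trace of an r_0 x r_0 matrix
satisfies |tr M|^2 <= r_0 |M|^2 (mxtrace_sqr_le), which gives
d r_0 delta^2 = (eps |T|)^2 for the closed tensor when r_0 > 0, and 0 when
r_0 = 0.

Each contribution is at most delta^2 because after the QR-sweep the family
P(i) = G_1(i_1) ... G_k(i_k) satisfies sum_i P(i)^T P(i) = 1 for every k < d
(qr_sweep_spec, left_orthogonal_slice_prod): multiplying the residual E of a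
truncated SVD by all the P(i) preserves its Frobenius norm (sqfrob_isometry).

The contributions add up in squares because the residual E = A - U S V^T of a
truncated SVD satisfies E V = 0 (tsvd_residual), whereas all the later errors
are made to the left of V^T and hence have their rows in the row space of V^T
(sqfrob_pythagoras, sqfrob_split_core).  An induction along the train then
bounds the SVD-sweep by (d - 1) delta^2 (svd_sweep_err).

The cyclic step seems to spoil this, as it moves V_d^T to the first core, whose
left orthogonality is lost.  But the SVD-sweep never looks at that factor: it
commutes with a multiplication on the far left (svd_sweep_mode1_first), so its
result is V_d^T H(i) with H computed from the left orthogonal cores.  By
cyclicity of the trace, tr (V_d^T H(i)) = tr (H(i) V_d^T), and in this form the
residual of the cyclic step is again orthogonal to everything that follows
(cyclic_step_err). *)

(** * Squared Frobenius norms *)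

Definition sqfrob (R : rcfType) p q (A : 'M[R]_(p, q)) : R := \tr (A *m A^T).

Lemma sqfrobE (R : rcfType) p q (A : 'M[R]_(p, q)) :
  sqfrob A = \sum_i \sum_j A i j ^+ 2.
Proof.
by apply: eq_bigr => i _; rewrite mxE; apply: eq_bigr => j _; rewrite mxE.
Qed.

Lemma sqfrob_ge0 (R : rcfType) p q (A : 'M[R]_(p, q)) : 0 <= sqfrob A.
Proof.
by rewrite sqfrobE !sumr_ge0 // => i _; rewrite sumr_ge0 // => j _; rewrite sqr_ge0.
Qed.

Lemma sqfrobD (R : rcfType) p q (A B : 'M[R]_(p, q)) :
  sqfrob (A + B) = sqfrob A + sqfrob B + \tr (A *m B^T) *+ 2.
Proof.
have trC: \tr (B *m A^T) = \tr (A *m B^T) by rewrite -mxtrace_tr trmx_mul trmxK.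
rewrite /sqfrob linearD /= mulmxDl !mulmxDr !mxtraceD trC; ring.
Qed.

(** Cauchy-Schwarz for M and the identity: expand |a M - (tr M) 1|^2 >= 0. *)
Lemma mxtrace_sqr_le (R : rcfType) a (M : 'M[R]_a) : \tr M ^+ 2 <= a%:R * sqfrob M.
Proof.
case: a M => [|a] M; first by rewrite /mxtrace big_ord0 mul0r expr0n.
have := sqfrob_ge0 (a.+1%:R *: M + (- \tr M)%:M).
rewrite sqfrobD /sqfrob tr_scalar_mx !linearZ /= -!scalemxAl !linearZ /= !mul_mx_scalar.
rewrite !linearZ /= mxtrace_scalar -[(- \tr M) *+ _]mulr_natr.
set t := \tr M; set s := \tr _; set c : R := a.+1%:R => h.
have c0 : 0 < c by rewrite ltr0n.
rewrite -subr_ge0 -(pmulr_rge0 _ c0).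
by apply: le_trans h _; rewrite le_eqVlt; apply/orP; left; apply/eqP; ring.
Qed.

Lemma mxfrob_sqr (R : rcfType) p q (A : 'M[R]_(p, q)) : mxfrob A ^+ 2 = sqfrob A.
Proof.
rewrite /mxfrob /frob sqr_sqrtr; last by apply: sumr_ge0 => i _; rewrite exprn_ge0.
rewrite sqfrobE pair_big /=; apply: eq_bigr => i _; exact: real_normK (num_real _).
Qed.

Lemma sqfrob_isometry (R : rcfType) (I : finType) a b c (P : I -> 'M[R]_(a, b))
    (E : 'M[R]_(b, c)) :
  \sum_i (P i)^T *m P i = 1%:M -> \sum_i sqfrob (P i *m E) = sqfrob E.
Proof.
move=> hP.
transitivity (\tr (E^T *m (\sum_i (P i)^T *m P i) *m E)).
  rewrite mulmx_sumr mulmx_suml linear_sum; apply: eq_bigr => i _ /=.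
  by rewrite /sqfrob mxtrace_mulC trmx_mul !mulmxA.
by rewrite hP mulmx1 mxtrace_mulC.
Qed.

(** The families E and V stand for the slices of a residual and of a factor with
    orthonormal rows; the mixed terms are traces of multiples of
    \sum_x E x *m (V x)^T, whatever P and M are. *)
Lemma sqfrob_pythagoras (R : rcfType) (I : finType) a b c r (P : 'M[R]_(a, b))
    (E : I -> 'M[R]_(b, c)) (M : 'M[R]_(a, r)) (V : I -> 'M[R]_(r, c)) :
  \sum_x V x *m (V x)^T = 1%:M -> \sum_x E x *m (V x)^T = 0 ->
  \sum_x sqfrob (P *m E x + M *m V x) = \sum_x sqfrob (P *m E x) + sqfrob M.
Proof.
move=> hV hE.
under eq_bigr do rewrite sqfrobD.
rewrite !big_split /= -mulr2n -[RHS]addr0; congr (_ + _ + _).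
  transitivity (\tr (M *m (\sum_x V x *m (V x)^T) *m M^T)); last by rewrite hV mulmx1.
  rewrite mulmx_sumr mulmx_suml linear_sum; apply: eq_bigr => i _ /=.
  by rewrite /sqfrob trmx_mul !mulmxA.
suff -> : \sum_i \tr (P *m E i *m (M *m V i)^T) =
    \tr (P *m (\sum_x E x *m (V x)^T) *m M^T).
  by rewrite hE mulmx0 mul0mx mxtrace0 mul0rn.
rewrite mulmx_sumr mulmx_suml linear_sum; apply: eq_bigr => i _ /=.
by rewrite trmx_mul !mulmxA.
Qed.

(** * Truncated singular value decompositions *)

(** The second conclusion holds because truncation keeps whole singular
    triples: V_r = V J and U_r S_r = U S J with J the inclusion of the first r
    coordinates, so A V_r = U S J = U_r S_r. *)
Lemma tsvd_residual (R : rcfType) p q (delta : R) (A : 'M[R]_(p, q)) (F : tsvd R p q) :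
  is_tsvd delta A F ->
  [/\ orthocols (tsvdV F), (A - tsvd_mx F) *m tsvdV F = 0
    & sqfrob (A - tsvd_mx F) <= delta ^+ 2].
Proof.
move=> [U [s [V [[dA _ oV _ _] [r [le_r [-> hd _ _]]]]]]].
have colsubE n m (B : 'M[R]_(n, m)) (f : 'I_r -> 'I_m) : colsub f B = B *m colsub f 1%:M.
  by apply/matrixP => i j; rewrite mulmx_colsub mulmx1.
set w := widen_ord le_r in hd *.
have w_inj : injective w by move=> i j [] /val_inj.
have oJ : (colsub w 1%:M)^T *m colsub w 1%:M = 1%:M :> 'M[R]_r.
  apply/matrixP => i j; rewrite mulmx_colsub mulmx1 !mxE.
  by rewrite (inj_eq w_inj) eq_sym.
have SJ : diag_mx s *m colsub w 1%:M = colsub w 1%:M *m diag_mx (colsub w s).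
  apply/matrixP => i j; rewrite mul_diag_mx mul_mx_diag !mxE.
  by case: eqP => [->|_]; rewrite ?mulr1 ?mul1r ?mulr0 ?mul0r.
have oVr : orthocols (colsub w V).
  by rewrite /orthocols (colsubE _ _ V) trmx_mul mulmxA -(mulmxA _ V^T) oV mulmx1.
split => //=.
  rewrite /tsvd_mx /= mulmxBl -[_ *m (colsub w V)^T *m _]mulmxA oVr mulmx1.
  rewrite dA -(mulmxA _ V^T) (colsubE _ _ V) (mulmxA V^T) oV mul1mx -mulmxA SJ.
  by rewrite mulmxA -colsubE subrr.
have m0 : 0 <= mxfrob (A - tsvd_mx (truncate U s V le_r)) by apply: sqrtr_ge0.
by rewrite -mxfrob_sqr ler_sqr ?nnegrE ?(le_trans m0).
Qed.

(** * Reshapes *)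

Lemma big_mxtens (V : nmodType) m n (F : 'I_m -> 'I_n -> V) :
  \sum_(p < m * n) F (mxtens_unindex p).1 (mxtens_unindex p).2 = \sum_i \sum_j F i j.
Proof.
rewrite pair_big (reindex (@mxtens_unindex m n)) //=.
by exists (@mxtens_index m n) => i; rewrite (mxtens_indexK, mxtens_unindexK).
Qed.

Lemma unfoldLK (R : Type) a n b (C : core R a n b) x : foldL (unfoldL C) x = C x.
Proof. by apply/matrixP => i j; rewrite !mxE mxtens_indexK. Qed.

Lemma unfoldRK (R : Type) a n b (C : core R a n b) x : foldR (unfoldR C) x = C x.
Proof. by apply/matrixP => i j; rewrite !mxE mxtens_indexK. Qed.

Lemma foldLD (R : rcfType) a n b (A B : 'M[R]_(n * a, b)) x :
  foldL (A + B) x = foldL A x + foldL B x.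
Proof. by apply/matrixP => i j; rewrite !mxE. Qed.

Lemma foldRD (R : rcfType) a n b (A B : 'M[R]_(a, b * n)) x :
  foldR (A + B) x = foldR A x + foldR B x.
Proof. by apply/matrixP => i j; rewrite !mxE. Qed.

Lemma foldL_mul (R : rcfType) a n b c (A : 'M[R]_(n * a, b)) (B : 'M[R]_(b, c)) x :
  foldL (A *m B) x = foldL A x *m B.
Proof.
by apply/matrixP => i j; rewrite !mxE; apply: eq_bigr => k _; rewrite mxE.
Qed.

Lemma foldR_mul (R : rcfType) a n b c (A : 'M[R]_(a, b)) (B : 'M[R]_(b, c * n)) x :
  foldR (A *m B) x = A *m foldR B x.
Proof.
by apply/matrixP => i j; rewrite !mxE; apply: eq_bigr => k _; rewrite mxE.
Qed.

Lemma sum_foldL (R : rcfType) a n b c (A : 'M[R]_(n * a, b)) (B : 'M[R]_(n * a, c)) :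
  \sum_x (foldL A x)^T *m foldL B x = A^T *m B.
Proof.
apply/matrixP => i j; rewrite summxE mxE.
transitivity (\sum_x \sum_y A (mxtens_index (x, y)) i * B (mxtens_index (x, y)) j).
  by apply: eq_bigr => x _; rewrite mxE; apply: eq_bigr => y _; rewrite !mxE.
rewrite -(big_mxtens (fun x y => A (mxtens_index (x, y)) i * _)).
by apply: eq_bigr => p _; rewrite mxE -surjective_pairing mxtens_unindexK.
Qed.

Lemma sum_foldR (R : rcfType) a n b c (A : 'M[R]_(a, b * n)) (B : 'M[R]_(c, b * n)) :
  \sum_x foldR A x *m (foldR B x)^T = A *m B^T.
Proof.
apply/matrixP => i j; rewrite summxE mxE.
transitivity (\sum_x \sum_y A i (mxtens_index (y, x)) * B j (mxtens_index (y, x))).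
  by apply: eq_bigr => x _; rewrite mxE; apply: eq_bigr => y _; rewrite !mxE.
rewrite exchange_big -(big_mxtens (fun y x => A i (mxtens_index (y, x)) * _)).
by apply: eq_bigr => p _; rewrite mxE -surjective_pairing mxtens_unindexK.
Qed.

Lemma sqfrob_foldR (R : rcfType) a n b (A : 'M[R]_(a, b * n)) :
  \sum_x sqfrob (foldR A x) = sqfrob A.
Proof. by rewrite /sqfrob -sum_foldR linear_sum. Qed.

(** * Sums over multi-indices *)

Definition mindex_unsnoc n k (i : mindex n k.+1) : mindex n k * 'I_(n k) :=
  ([ffun j => i (widen_ord (leqnSn k) j)], i ord_max).

(** Injectivity and a count of both sides avoid building the inverse, which
    would need transports between the dependent index types. *)
Lemma mindex_unsnoc_bij n k : bijective (@mindex_unsnoc n k).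
Proof.
apply: inj_card_bij => [i i' [/ffunP e e'] |].
  apply/ffunP => j; case: (unliftP ord_max j) => [j' ->|-> //].
  have -> : lift ord_max j' = widen_ord (leqnSn k) j'.
    by apply: val_inj; rewrite /= /bump leqNgt ltn_ord.
  by have := e j'; rewrite !ffunE.
rewrite card_prod !card_dep_ffun card_ord !foldrE !big_image /= big_ord_recr /=.
by rewrite card_ord leqnn.
Qed.

Lemma mindex1_bij n : bijective (fun i : mindex n 1 => i ord0).
Proof.
apply: inj_card_bij => [i i' e |].
  by apply/ffunP => j; rewrite ord1.
by rewrite card_dep_ffun !foldrE !big_image /= big_ord1 !card_ord leqnn.
Qed.

Lemma slice_prod_ext (R : rcfType) n a k b (G : train R n a k b)
    (i i' : forall j : 'I_k, 'I_(n j)) :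
  (forall j, i j = i' j) -> slice_prod G i = slice_prod G i'.
Proof.
elim: G i i' => [c C|k' c e G IH C] i i' h /=; first by rewrite h.
by rewrite (h ord_max); congr (_ *m _); apply: IH => j; exact: (h (widen_ord (leqnSn k') j)).
Qed.

Lemma sum_mindexS (V : nmodType) n k (F : mindex n k -> 'I_(n k) -> V) :
  \sum_(i : mindex n k.+1) F (mindex_unsnoc i).1 (mindex_unsnoc i).2 = \sum_i \sum_x F i x.
Proof. by rewrite pair_big [RHS](reindex _ (onW_bij _ (mindex_unsnoc_bij n k))). Qed.

Lemma slice_prod_Snoc (R : rcfType) n a k b c (G : train R n a k b) (C : core R b (n k) c)
   (i : mindex n k.+1) :
  slice_prod (Snoc G C) i = slice_prod G (mindex_unsnoc i).1 *m C (mindex_unsnoc i).2.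
Proof. by congr (_ *m _); apply: slice_prod_ext => j; rewrite ffunE. Qed.

(** * Left orthogonal trains and the QR-sweep *)

Fixpoint left_orthogonal (R : rcfType) n a k b (G : train R n a k b) : Prop :=
  match G with
  | One _ C => \sum_x (C x)^T *m C x = 1%:M
  | Snoc _ _ _ G' C => left_orthogonal G' /\ \sum_x (C x)^T *m C x = 1%:M
  end.

Lemma left_orthogonal_slice_prod (R : rcfType) n a k b (G : train R n a k b) :
  left_orthogonal G -> \sum_(i : mindex n k) (slice_prod G i)^T *m slice_prod G i = 1%:M.
Proof.
elim: G => [c C|k' c e G IH C] /=.
  by move<-; rewrite [RHS](reindex _ (onW_bij _ (mindex1_bij n))).
move=> [/IH hG hC].
transitivity (\sum_(i : mindex n k'.+1)
    (slice_prod (Snoc G C) i)^T *m slice_prod (Snoc G C) i) => //.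
under eq_bigr do rewrite slice_prod_Snoc.
rewrite (sum_mindexS (fun i x => (slice_prod G i *m C x)^T *m (slice_prod G i *m C x))).
rewrite exchange_big -hC; apply: eq_bigr => x _ /=.
transitivity ((C x)^T *m (\sum_(i : mindex n k') (slice_prod G i)^T *m slice_prod G i) *m C x).
  rewrite mulmx_sumr mulmx_suml; apply: eq_bigr => i _.
  by rewrite trmx_mul !mulmxA.
by rewrite hG mulmx1.
Qed.

Lemma qr_sweep_spec (R : rcfType) (qr : qr_routine R) n a k b (G : train R n a k b) :
  qr_correct qr ->
  let: existT _ (G', T) := qr_sweep qr G in
  left_orthogonal G' /\ forall i, slice_prod G i = slice_prod G' i *m T.
Proof.
move=> hqr; elim: G => [b' C|k' b' c' G IH C] /=.
  have [e o _] := hqr _ _ (unfoldL C).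
  split=> [|i]; first by rewrite sum_foldL.
  by rewrite -foldL_mul -e unfoldLK.
case: (qr_sweep qr G) IH => b'' [G' T] [hG' e'] /=.
have [e o _] := hqr _ _ (unfoldL (mode1 C T)).
split=> [|i]; first by rewrite sum_foldL.
by rewrite -[RHS]mulmxA -foldL_mul -e unfoldLK /mode1 mulmxA -e'.
Qed.

(** * The SVD-sweep *)

(** One truncation.  Writing C(x) = E(x) + U S V^T(x), the error is
    P(i) E(x) + (P(i) U S - M(i)) V^T(x): its two parts are orthogonal because
    E V = 0, and the first has the norm of E because the P(i) form an isometry.
    The second is the error made when M approximates the train in which U S has
    been absorbed, as the remaining steps of the sweep do. *)
Lemma sqfrob_split_core (R : rcfType) (I : finType) a b n c (delta : R)
    (P : I -> 'M[R]_(a, b)) (C : core R b n c) (F : tsvd R b (c * n)) (M : I -> 'M[R]_(a, tsvd_rank F)) :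
  \sum_i (P i)^T *m P i = 1%:M -> is_tsvd delta (unfoldR C) F ->
  \sum_i \sum_x sqfrob (P i *m C x - M i *m foldR (tsvdV F)^T x)
    <= delta ^+ 2 + \sum_i sqfrob (P i *m (tsvdU F *m tsvdS F) - M i).
Proof.
move=> hP /tsvd_residual [oV EV hE].
set Vt := foldR (tsvdV F)^T; set E := foldR (unfoldR C - tsvd_mx F).
have CE x : C x = E x + tsvdU F *m tsvdS F *m Vt x.
  by rewrite -foldR_mul -/(tsvd_mx F) -[LHS]unfoldRK -foldRD subrK.
have VV : \sum_x Vt x *m (Vt x)^T = 1%:M by rewrite sum_foldR trmxK.
have EV0 : \sum_x E x *m (Vt x)^T = 0 by rewrite sum_foldR trmxK.
under eq_bigr => i _.
  under eq_bigr => x _ do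
    rewrite CE mulmxDr -addrA [P i *m (_ *m Vt x)]mulmxA -mulmxBl.
  rewrite sqfrob_pythagoras //; over.
rewrite big_split /= lerD2r exchange_big /=.
under eq_bigr do rewrite sqfrob_isometry //.
by rewrite sqfrob_foldR.
Qed.

(** Induction along the train, for all last cores at once: the sweep of
    [Snoc (Snoc G C') C] truncates C and continues as the sweep of [G] with the
    last core C' U S. *)
Lemma svd_sweep_err (R : rcfType) (svd : svd_routine R) (delta : R) n a k b
    (G : train R n a k b) : svd_correct svd -> 0 <= delta -> left_orthogonal G ->
  forall c (C : core R b (n k) c),
  \sum_(i : mindex n k.+1)
     sqfrob (slice_prod (Snoc G C) i - slice_prod (svd_sweep svd delta G C) i)
  <= k%:R * delta ^+ 2.
Proof.
move=> hsvd d0; elim: G => [b' C'|k' b' c' G IH C'] hG c C.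
  set F := svd _ _ delta (unfoldR C).
  have hP := left_orthogonal_slice_prod hG.
  have := sqfrob_split_core
    (fun i : mindex n 1 => C' (i ord0) *m (tsvdU F *m tsvdS F))
    hP (hsvd _ _ _ (unfoldR C) d0).
  rewrite mul1r [X in _ <= _ + X]big1 ?addr0 => [|i _]; last first.
    by rewrite /= subrr /sqfrob mul0mx mxtrace0.
  apply: le_trans.
  rewrite -(sum_mindexS (fun i x => sqfrob (slice_prod (One C') i *m C x -
     C' (i ord0) *m (tsvdU F *m tsvdS F) *m foldR (tsvdV F)^T x))).
  rewrite le_eqVlt; apply/orP; left; apply/eqP; apply: eq_bigr => i _.
  by rewrite [svd_sweep _ _ _ _]/= !slice_prod_Snoc /= /mode3 trmxK.
have hP := left_orthogonal_slice_prod hG; case: hG => hG _.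
set F := svd _ _ delta (unfoldR C).
set D := mode3 C' (tsvdU F *m tsvdS F)^T.
have := sqfrob_split_core (fun i : mindex n k'.+1 => slice_prod (svd_sweep svd delta G D) i)
  hP (hsvd _ _ _ (unfoldR C) d0).
rewrite -(sum_mindexS (fun i x => sqfrob (slice_prod (Snoc G C') i *m C x -
     slice_prod (svd_sweep svd delta G D) i *m foldR (tsvdV F)^T x))).
have -> : k'.+1%:R * delta ^+ 2 = delta ^+ 2 + k'%:R * delta ^+ 2.
  by rewrite mulrS mulrDl mul1r.
move=> h; apply: le_trans (le_trans h _).
  rewrite le_eqVlt; apply/orP; left; apply/eqP; apply: eq_bigr => i _.
  by rewrite [svd_sweep _ _ _ _]/= !slice_prod_Snoc.
rewrite lerD2l; apply: le_trans (IH hG _ D).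
rewrite le_eqVlt; apply/orP; left; apply/eqP; apply: eq_bigr => i _.
by rewrite /= -mulmxA /D /mode3 trmxK.
Qed.

(** The sweep factors only the cores to the right of the first one, so a factor
    on the far left never enters an SVD. *)
Lemma svd_sweep_mode1_first (R : rcfType) (svd : svd_routine R) (delta : R) n a a' k b
    (A : 'M[R]_(a', a)) (G : train R n a k b) c (C : core R b (n k) c) i :
  slice_prod (svd_sweep svd delta (mode1_first A G) C) i =
  A *m slice_prod (svd_sweep svd delta G C) i.
Proof.
elim: G c C i => [b' C'|k' b' c' G IH C'] c C i /=; first by rewrite /mode3 /mode1 !mulmxA.
by rewrite IH mulmxA.
Qed.

(** * The cyclic step *)

Lemma unsnoc_spec (R : rcfType) n a k c (G : train R n a k.+2 c) :
  let: existT _ (G1, C1) := unsnoc G in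
  forall i, slice_prod G i = slice_prod (Snoc G1 C1) i.
Proof.
(* Case analysis on [G] needs a predicate defined at every length. *)
pose P k' c' : train R n a k' c' -> Prop :=
  match k' with
  | k0.+2 => fun G => let: existT _ (G1, C1) := unsnoc G in
     forall i, slice_prod G i = slice_prod (Snoc G1 C1) i
  | _ => fun _ => True
  end.
suff h k' c' (G' : train R n a k' c') : P k' c' G' by exact: (h _ _ G).
by case: G' => [//|[|k0] b' e G0 C0].
Qed.

(** The factor r_0 comes from the trace; the remaining [k.+1] counts the k
    truncations of the sweep and the cyclic one.  In the truncated case the
    error is written as the trace of Q(x) E + (P C3 - H) V^T, with the factor
    V^T of the first core turned around to the right end. *)
Lemma cyclic_step_err (R : rcfType) (qr : qr_routine R) (svd : svd_routine R) (delta : R)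
    n a k b (G : train R n a k b) (C : core R b (n k) a) :
  qr_correct qr -> svd_correct svd -> 0 <= delta -> left_orthogonal G ->
  let: existT _ (G', C') := cyclic_step qr svd delta G C in
  \sum_(i : mindex n k.+1)
    (\tr (slice_prod (Snoc G C) i) - \tr (slice_prod (svd_sweep svd delta G' C') i)) ^+ 2
  <= k.+1%:R * a%:R * delta ^+ 2.
Proof.
move=> hqr hsvd d0 hG; rewrite /cyclic_step.
have [eC oQ _] := hqr _ _ (unfoldL C).
set Q := (qr _ _ (unfoldL C)).1 in eC oQ *; set T := (qr _ _ (unfoldL C)).2 in eC *.
set F := svd _ _ delta T.
case: ifP => _; last first.
  have h := svd_sweep_err hsvd d0 hG C.
  apply: le_trans (_ : a%:R * (k%:R * delta ^+ 2) <= _); last first.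
    rewrite mulrA [_ * k%:R]mulrC ler_wpM2r ?sqr_ge0 // ler_wpM2r ?ler0n //.
    by rewrite ler_nat leqnSn.
  apply: le_trans (ler_wpM2l (ler0n _ a) h).
  rewrite mulr_sumr; apply: ler_sum => i _.
  by rewrite -linearB /= mxtrace_sqr_le.
have [oV EV hE] := tsvd_residual (hsvd _ _ _ T d0).
set C3 := foldL (Q *m tsvdU F *m tsvdS F).
set E := T - tsvd_mx F.
set H := svd_sweep svd delta G C3.
have err i : \tr (slice_prod (Snoc G C) i) -
    \tr (slice_prod (svd_sweep svd delta (mode1_first (tsvdV F)^T G) C3) i) =
    \tr (slice_prod (Snoc G (foldL Q)) i *m E +
      (slice_prod (Snoc G C3) i - slice_prod H i) *m (tsvdV F)^T).
  rewrite svd_sweep_mode1_first [in X in _ - X]mxtrace_mulC -linearB /= -/H; congr (\tr _).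
  rewrite mulmxBl addrA; congr (_ - _).
  rewrite -!mulmxA -mulmxDr -!foldL_mul; congr (_ *m _).
  rewrite -[LHS]unfoldLK eC -foldLD; congr (foldL _ _).
  have -> : Q *m tsvdU F *m tsvdS F *m (tsvdV F)^T = Q *m tsvd_mx F.
    by rewrite !mulmxA.
  by rewrite -mulmxDr subrK.
under eq_bigr do rewrite err.
apply: le_trans (_ : a%:R * (k.+1%:R * delta ^+ 2) <= _); last first.
  by rewrite mulrA [_ * k.+1%:R]mulrC.
apply: le_trans (_ : _ <= \sum_(i : mindex n k.+1) a%:R * _) _.
  by apply: ler_sum => i _; apply: mxtrace_sqr_le.
rewrite -mulr_sumr ler_wpM2l ?ler0n //.
have pyth (N : 'M[R]_(a, _)) (M : 'M[R]_(a, _)) :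
    sqfrob (N *m E + M *m (tsvdV F)^T) = sqfrob (N *m E) + sqfrob M.
  (* The residual E is not sliced here: a family with a single member. *)
  have := @sqfrob_pythagoras R 'I_1 _ _ _ _ N (fun=> E) M (fun=> (tsvdV F)^T).
  by rewrite !big_ord1 trmxK; apply.
under eq_bigr do rewrite pyth.
rewrite big_split /= sqfrob_isometry; last first.
  apply: (@left_orthogonal_slice_prod _ _ _ _ _ (Snoc G (foldL Q))).
  by split => //; rewrite sum_foldL.
by rewrite mulrS mulrDl mul1r lerD // svd_sweep_err.
Qed.

Theorem theorem3p1 (R : rcfType) (d : nat) (hd : (2 <= d)%N) (n : nat -> nat)
    (T : tensor R n d) (G : tr_format R n d) (hT : forall i, T i = tr_tensor G i)
    (eps : R) (heps : 0 <= eps)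
    (qr : qr_routine R) (hqr : qr_correct qr)
    (svd : svd_routine R) (hsvd : svd_correct svd) :
  frob (fun i => T i - tr_tensor (tr_rounding qr svd eps G) i) <= eps * frob T.
Proof.
have frobE (f g : mindex n d -> R) : f =1 g -> frob f = frob g.
  by move=> e; congr Num.sqrt; apply: eq_bigr => i _; rewrite e.
rewrite (frobE T (tr_tensor G)) //.
rewrite (frobE _ (fun i => tr_tensor G i - tr_tensor (tr_rounding qr svd eps G) i));
  last first.
  by move=> i; rewrite hT.
move: G {frobE T hT}; case: d hd => [|[|d]] // _ G.
rewrite /tr_rounding /tr_rounding2.
set delta := eps * _ / _.
have f0 : 0 <= frob (tr_tensor G) by apply: sqrtr_ge0.
have d0 : 0 <= delta by rewrite !mulr_ge0 ?invr_ge0 ?sqrtr_ge0.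
(* For r_0 = 0 the quotient defining delta is a division by 0, and the left-hand
   side vanishes anyway. *)
have step : d.+2%:R * (tr_rank G)%:R * delta ^+ 2 <= (eps * frob (tr_tensor G)) ^+ 2.
  have [->|r0] := posnP (tr_rank G); first by rewrite mulr0 mul0r sqr_ge0.
  rewrite /delta expr_div_n sqr_sqrtr ?ler0n // natrM mulrC divfK //.
  by rewrite mulf_neq0 ?pnatr_eq0 -?lt0n.
have e0 : 0 <= eps * frob (tr_tensor G) by rewrite mulr_ge0.
rewrite -[_ <= _]ler_sqr ?nnegrE ?sqrtr_ge0 // sqr_sqrtr; last first.
  by apply: sumr_ge0 => i _; rewrite exprn_ge0.
apply: le_trans step.
have := unsnoc_spec (tr_cores G).
case: (unsnoc _) => b [G1 C1] hG.
have := qr_sweep_spec G1 hqr.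
case: (qr_sweep _ _) => b' [G2 T] [hG2 e2].
have := cyclic_step_err (mode1 C1 T) hqr hsvd d0 hG2.
case: (cyclic_step _ _ _ _ _) => r [G3 C3] /=; apply: le_trans.
rewrite le_eqVlt; apply/orP; left; apply/eqP; apply: eq_bigr => i _.
rewrite real_normK ?num_real // /tr_tensor hG /=.
by rewrite e2 /mode1 mulmxA.
Qed.
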